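(* For each integer $n\ge 1$ let $D_{n,n}^+$ be the one-sided two-sample Kolmogorov–Smirnov statistic with equal sample sizes $n$, computed from independent real random variables $X_1,\dots,X_n,Y_1,\dots,Y_n$ with a common continuous distribution function, and let $N=2n$. Then: (a) For all $n\ge 1$ and all $t>0$, $$P(D_{n,n}^+\ge t)\le \frac{e}{2}\exp(-2t^2).$$ For this range of $n$ the constant $e/2$ is sharp: equality occurs for $n=1$ and $t=1/\sqrt2$. (b) For all $n\ge 5$ and all $t>0$, $$P(D_{n,n}^+\ge t)\le C\exp(-2t^2)\quad\text{with } C=2.16863/2=1.084315.$$ (c) For every $n\ge 1$ the inequality ''$P(D_{n,n}^+\ge t)\le \exp(-2t^2)$ for all $t>0$'' fails; that is, for every $n\ge1$ there exists $t>0$ with $P(D_{n,n}^+\ge t)>\exp(-2t^2)$. (d) For all $n\ge 1$ and all $t>0$, $$P(D_{n,n}^+\ge t)\le \exp\left(-2\left(\frac{N-1}{N}\right)t^2\right).$$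
   Context: With $\mathbb F_n(x)=n^{-1}\sum_{i=1}^n 1\{X_i\le x\}$ and $\mathbb G_n(x)=n^{-1}\sum_{i=1}^n 1\{Y_i\le x\}$ the empirical distribution functions of the two samples, $D_{n,n}^+=\sqrt{n^2/(2n)}\,\sup_{x\in\mathbb R}(\mathbb F_n(x)-\mathbb G_n(x))=\sqrt{n/2}\,\sup_{x\in\mathbb R}(\mathbb F_n(x)-\mathbb G_n(x))$. *)

(* Defs.v *)
From HB Require Import structures.
From mathcomp Require Import all_boot all_order all_algebra.
From mathcomp Require Import all_classical all_reals all_analysis.

Set Implicit Arguments.
Unset Strict Implicit.
Unset Printing Implicit Defensive.
Import Order.TTheory GRing.Theory Num.Theory.
Import numFieldNormedType.Exports.
Local Open Scope classical_set_scope.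
Local Open Scope ring_scope.

Definition mutually_independent (R : realType) (d : measure_display)
    (T : measurableType d) (P : probability T R) (I : finType)
    (Z : I -> {RV P >-> R}) : Prop :=
  forall (J : {set I}) (B : I -> set R),
    (forall i, i \in J -> measurable (B i)) ->
    P (\bigcap_(i in [set` J]) (Z i @^-1` B i)) =
    (\prod_(i in J) P (Z i @^-1` B i))%E.

(* The family indexed by the disjoint union of the two index sets, so that
   independence also holds across the samples. *)
Definition joint_sample (R : realType) (d : measure_display)
    (T : measurableType d) (P : probability T R) (n : nat)
    (X Y : 'I_n -> {RV P >-> R}) (k : 'I_n + 'I_n) : {RV P >-> R} :=
  match k with inl i => X i | inr j => Y j end.

Definition ecdf (R : realType) (n : nat) (z : 'I_n -> R) (x : R) : R :=
  n%:R^-1 * \sum_(i < n) (z i <= x)%R%:R.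

(* Over all real x the difference of the two empirical distribution functions
   is bounded by 1 in absolute value, so the real-valued supremum [sup] is the
   genuine one. *)
Definition ks_plus (R : realType) (n : nat) (x y : 'I_n -> R) : R :=
  Num.sqrt (n%:R / 2) * sup (range (fun u => ecdf x u - ecdf y u)).

Definition ks_plus_tail (R : realType) (d : measure_display)
    (T : measurableType d) (P : probability T R) (n : nat)
    (X Y : 'I_n -> {RV P >-> R}) (t : R) : \bar R :=
  P [set w | t <= ks_plus (fun i => X i w) (fun i => Y i w)].

(* Main.v *)
Require Import Defs.
From HB Require Import structures.
From mathcomp Require Import all_boot all_order all_algebra.
From mathcomp Require Import all_classical all_reals all_analysis.
From mathcomp Require Import measurable_realfun.
From mathcomp Require Import zify ring lra.

(** The proof computes the tail exactly and then compares it with a Gaussian.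

    The event that the statistic is at least [t > 0] says that, at some sample
    point, the [X]-count exceeds the [Y]-count by at least
    [k = ceil (t sqrt (2n))] ([ks_plus_ge]).  It only involves the relative order
    of the [2n] pooled observations.  These are exchangeable ([exchangeable])
    and almost surely distinct ([no_ties]), so the probability does not change
    when the set of indices labelled as first sample is replaced by any other
    set of [n] indices.  Averaging over all such sets, one is left with counting,
    for a fixed vector of distinct reals, the labellings whose +1/-1 path through
    the sorted values reaches level [k]; by the reflection principle there are
    ['C(2n, n + k)] of them ([card_lead]).  Hence the tail equals
    [r k = 'C(2n, n + k) / 'C(2n, n)] ([ks_plus_tailE]), the classical formula of
    Gnedenko and Korolyuk.

    For the comparison put [u = k / n].  Since
    [r k = (1 + u)^-1 * prod_(0 < i < k) (1 - i/n) / (1 + i/n)], the expansion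
    [ln ((1 - x) / (1 + x)) <= - 2 x - 2 x^3 / 3] bounds [(1 + u) * r k] by
    [exp (- k^2 / n)] times [exp (u - (n / 6) u^2 (u - 1/n)^2)]
    ([central_ratio_bound]).  What remains is to compare this last factor with
    [1 + u] on [0 <= u <= 1]: dropping the quartic term, [exp u <= (1 + u) e / 2]
    gives (a) and [exp u <= (1 + u) exp (u^2 / 2)] gives (d); keeping it gives (b),
    except for [n = 5, k = 3], which is a numerical check.  Taking [k = 1], where
    [r 1 = n / (n + 1) > exp (- 1 / n)], gives (c), and [n = k = 1] is the equality
    case of (a).  The finer estimates all come from one monotone function:
    [(1 + u) exp (- p u)] is nondecreasing on the whole line, where [p] is the
    fourth Taylor polynomial of [ln (1 + u)] ([log1p_poly_homo]). *)

Set Implicit Arguments.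
Unset Strict Implicit.
Unset Printing Implicit Defensive.
Import Order.TTheory GRing.Theory Num.Theory.
Import numFieldNormedType.Exports.
Local Open Scope classical_set_scope.
Local Open Scope ring_scope.

(** * Ballot words and the reflection principle *)

Fixpoint words (m : nat) : seq (seq bool) :=
  if m is m'.+1 then map (cons true) (words m') ++ map (cons false) (words m')
  else [:: [::]].

(** A word is read as a walk, [true] being a step up.  [hits k w] says that the
    walk [w], started at 0, visits level [k]; [k] is the distance that remains
    to be climbed, and the recursion stops at the first visit. *)
Fixpoint hits (k : nat) (w : seq bool) : bool :=
  (k == 0)%N ||
  (if w is b :: w' then hits (if b then k.-1 else k.+1) w' else false).

Lemma count_words (m a : nat) :
  count (fun w => count id w == a) (words m) = 'C(m, a).
Proof.
elim: m a => [|m IHm] [|a] //=; rewrite count_cat !count_map /preim /=.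
  rewrite (@eq_count _ _ pred0) ?count_pred0 //.
  by rewrite (@eq_count _ _ (fun w => count id w == 0%N)) // IHm !bin0.
by rewrite binS [RHS]addnC -!IHm.
Qed.

(** Reflection principle.  Reflecting a walk with [a] steps up after its first
    visit to [k] gives a walk with [m + k - a] steps up, and every such walk
    visits [k] because it ends at or above it: this is what [2 * a <= m + k]
    ensures.  In the proof the reflection is hidden in Pascal's rule, since both
    sides satisfy the same recurrence in the first step. *)
Lemma count_words_hits (m a k : nat) : (2 * a <= m + k)%N ->
  count (fun w => (count id w == a) && hits k w) (words m) = 'C(m, m + k - a).
Proof.
elim: m a k => [|m IHm] a k ha.
  case: k a ha => [|k] [|a] //= ha; rewrite ?bin_small ?andbF //; lia.
case: k ha => [|k] ha.
  rewrite (@eq_count _ _ (fun w => count id w == a)); last first.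
    by case=> [|b w] /=; rewrite andbT.
  by rewrite count_words addn0 bin_sub //; lia.
rewrite [words _]/= count_cat !count_map.
rewrite [X in (_ + X)%N](@eq_count _ _
  (fun w => (count id w == a) && hits k.+2 w)) // IHm; last by lia.
case: a ha => [|a] ha.
  rewrite (@eq_count _ _ pred0) ?count_pred0; last by case.
  by rewrite !bin_small //; lia.
rewrite (@eq_count _ _ (fun w => (count id w == a) && hits k w)) //.
rewrite IHm; last by lia.
have -> : (m.+1 + k.+1 - a.+1 = (m + k - a).+1)%N by lia.
have -> : (m + k.+2 - a.+1 = (m + k - a).+1)%N by lia.
by rewrite binS addnC.
Qed.

(** A walk moves by unit steps, so visiting [k] amounts to being at or above [k] at
    some time. *)
Lemma hitsP (k : nat) (w : seq bool) :
  reflect (exists2 p, (p <= size w)%N &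
            (k + count negb (take p w) <= count id (take p w))%N)
          (hits k w).
Proof.
elim: w k => [|b w IHw] k.
  rewrite /= orbF; apply: (iffP eqP) => [->|[p _]]; first by exists 0%N.
  by case: k.
case: k => [|k].
  by apply: (iffP idP) => // _; exists 0%N.
apply: (iffP (IHw _)) => /= [[p hp hk]|[[|p] hp]].
- by exists p.+1 => //=; case: b hk => /=; lia.
- by rewrite /=; lia.
- by move=> /= hk; exists p => //; case: b hk => /=; lia.
Qed.

Lemma size_words m : size (words m) = (2 ^ m)%N.
Proof. by elim: m => //= m IH; rewrite size_cat !size_map IH expnS; lia. Qed.

Lemma mem_words m (w : seq bool) : (w \in words m) = (size w == m).
Proof.
elim: m w => [|m IH] [|b w] //=; rewrite mem_cat.
  by apply/norP; split; apply/mapP => -[].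
have inj c : injective (cons c : seq bool -> _) by move=> ? ? [].
case: b; rewrite mem_map // IH eqSS ?orbF //.
  by case: mapP => [[? _ []] //|_]; rewrite orbF.
by case: mapP => [[? _ []] //|_].
Qed.

Definition word (I : finType) (s : seq I) (A : {set I}) : seq bool :=
  [seq i \in A | i <- s].

(** Once the index type is enumerated without repetition, subsets and words are
    in bijection, so a count of subsets is a count of words. *)
Lemma perm_word (I : finType) (s : seq I) : uniq s -> s =i I ->
  perm_eq [seq word s A | A <- enum {set I}] (words #|I|).
Proof.
move=> us sI.
have szs : size s = #|I| by rewrite -(card_uniqP us); apply: eq_card.
have card_sets : #|{set I}| = (2 ^ #|I|)%N.
  by have := card_powerset [set: I]%SET; rewrite powersetT !cardsT.
have injw : injective (word s).
  move=> A B AB; apply/setP => i.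
  have /eq_in_map/(_ i) : word s A = word s B by [].
  by rewrite sI; apply.
have uw : uniq [seq word s A | A <- enum {set I}].
  by rewrite map_inj_uniq ?enum_uniq.
have sub : {subset [seq word s A | A <- enum {set I}] <= words #|I|}.
  by move=> _ /mapP[A _ ->]; rewrite mem_words size_map szs.
have sz : (size (words #|I|) <= size [seq word s A | A <- enum {set I}])%N.
  by rewrite size_words size_map -cardE card_sets.
have [_ e] := uniq_min_size uw sub sz.
apply: uniq_perm => //; rewrite (uniq_size_uniq uw e).
by rewrite size_words size_map -cardE card_sets.
Qed.

(** * Counting labellings of distinct values *)

(** The order-theoretic form of a large one-sided statistic: at some data point
    the indices in [A] lead those outside [A] by at least [k].  Restricting the
    level to the finitely many data points makes this a boolean. *)
Definition lead (R : realType) (I : finType) (k : nat) (A : {set I}) (z : I -> R)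
    : bool :=
  [exists j, (k + #|[pred i | (i \notin A) && (z i <= z j)%R]|
              <= #|[pred i in A | (z i <= z j)%R]|)%N].

(** When the values are distinct, the counts at the [p]-th smallest value are the
    counts in the prefix of length [p + 1] of the word.  The empty prefix has no
    counterpart among the data points, whence [0 < k]. *)
Lemma lead_hits (R : realType) (I : finType) (k : nat) (A : {set I}) (z : I -> R)
  (s : seq I) : (0 < k)%N -> injective z -> uniq s -> s =i I ->
  sorted (fun i j => z i <= z j) s ->
  lead k A z = hits k (word s A).
Proof.
move=> k0 injz us sI srt.
have szs : size s = #|I| by rewrite -(card_uniqP us); apply: eq_card.
have tr : transitive (fun i j => z i <= z j) by move=> a b c; apply: le_trans.
have pre (p : nat) (j0 : I) (q : pred I) : (p < size s)%N ->
    #|[pred i | q i && (z i <= z (nth j0 s p))]| = count q (take p.+1 s).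
  move=> ps.
  have -> : count q (take p.+1 s) = size [seq i <- take p.+1 s | q i].
    by rewrite size_filter.
  have uf : uniq [seq i <- take p.+1 s | q i] by rewrite filter_uniq // take_uniq.
  rewrite -(card_uniqP uf); apply: eq_card => i.
  rewrite !inE mem_filter; congr (_ && _).
  have is_ : i \in s by rewrite sI.
  rewrite in_take // ltnS.
  have [ip|pi] := leqP (index i s) p.
    have := sorted_leq_nth tr (fun a => lexx (z a)) j0 srt.
    move=> /(_ (index i s) p); rewrite !inE index_mem nth_index //; exact.
  apply/negbTE; rewrite -ltNge lt_neqAle; apply/andP; split.
    apply/eqP => /injz e; move: pi; rewrite -e index_uniq // ltnn //.
  have := sorted_leq_nth tr (fun a => lexx (z a)) j0 srt.
  move=> /(_ p (index i s)); rewrite !inE index_mem nth_index //; apply => //.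
  exact: ltnW.
apply/existsP/hitsP => [[j hj]|[p]].
  have js : j \in s by rewrite sI.
  exists (index j s).+1; first by rewrite size_map index_mem.
  rewrite /word -map_take !count_map.
  have := pre (index j s) j; rewrite index_mem js nth_index // => pr.
  rewrite -(pr (fun i => i \notin A)) // -(pr (mem A)) //.
rewrite size_map => hp; case: p hp => [|p] hp.
  by rewrite take0 /=; lia.
rewrite /word -map_take !count_map.
have j0 : I by case: (s) hp.
move=> hk; exists (nth j0 s p).
rewrite (pre p j0 (fun i => i \notin A)) // (pre p j0 (mem A)) //.
Qed.

(** Sorting the values turns labellings into words and leads into visits. *)
Lemma card_lead (R : realType) (I : finType) (k a : nat) (z : I -> R) :
  injective z -> (0 < k)%N -> (2 * a <= #|I| + k)%N ->
  #|[pred A : {set I} | (#|A| == a) && lead k A z]| = 'C(#|I|, #|I| + k - a).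
Proof.
move=> injz k0 ha.
pose s := sort (fun i j => z i <= z j) (enum I).
have us : uniq s by rewrite sort_uniq enum_uniq.
have sI : s =i I by move=> i; rewrite mem_sort mem_enum.
have srt : sorted (fun i j => z i <= z j) s.
  by apply: sort_sorted => i j; apply: le_total.
rewrite -(count_words_hits ha).
have /seq.permP/(_ (fun w => (count id w == a) && hits k w)) <- := perm_word us sI.
rewrite count_map enumT cardE /enum_mem size_filter.
apply: eq_count => A /=; rewrite !inE.
rewrite -(lead_hits _ k0 injz us sI srt) /word count_map; congr ((_ == _) && _).
rewrite cardE /enum_mem size_filter -enumT.
by apply/seq.permP; rewrite perm_sym perm_sort.
Qed.

(** * Independent identically distributed families *)

(** The open upper rays form a pi-system that generates the Borel sets. *)
Lemma eq_cdf_law (R : realType) (d : measure_display) (T : measurableType d)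
    (P : probability T R) (X Y : {RV P >-> R}) :
  (forall x, cdf X x = cdf Y x) ->
  forall B, measurable B -> P (X @^-1` B) = P (Y @^-1` B).
Proof.
move=> XY B mB.
have ray (Z : {RV P >-> R}) x :
    (distribution P Z `]x, +oo[ = 1 - cdf Z x)%E.
  by rewrite -setCitvl probability_setC.
apply: (@measure_unique _ R _ (@RGenOInfty.G R) (fun n => `]- n%:R, +oo[%classic)
  _ _ _ _ (distribution P X) (distribution P Y)) => //.
- exact: RGenOInfty.measurableE.
- move=> _ _ [x ->] [y ->]; exists (Num.max x y).
  by apply/seteqP; split=> z /=; rewrite !in_itv /= !andbT gt_max => /andP.
- by move=> n; exists (- n%:R).
- rewrite -subTset => x _; exists (Num.truncn (- x)).+1 => //=.
  by rewrite in_itv /= andbT ltrNl truncnS_gt.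
- move=> _ [x ->]; transitivity (1 - cdf X x)%E; first exact: ray.
  by rewrite XY; exact/esym/ray.
- by move=> n; rewrite (le_lt_trans (probability_le1 _ _)) ?ltry.
Qed.

(** The measurable boxes generate the product sigma-algebra on [I -> R] and form a
    pi-system: two laws of families that agree on boxes agree. *)
Definition boxes (R : realType) (I : finType) : set (set (I -> R)) :=
  [set E | exists2 B : I -> set R, (forall i, measurable (B i)) &
             E = [set z | forall i, B i (z i)]].

Arguments boxes : clear implicits.

Lemma measurable_coord (R : realType) (I : finType) (i : I) :
  measurable_fun setT (fun z : g_sigma_algebraType (boxes R I) => z i).
Proof.
move=> _ B mB; rewrite setTI; apply: sub_sigma_algebra.
exists (fun j => if j == i then B else setT) => [j|]; first by case: ifP.
apply/seteqP; split=> z /=; first by move=> Bz j; case: eqP => // ->.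
by move/(_ i); rewrite eqxx.
Qed.

Lemma measurable_family (R : realType) (I : finType) (d : measure_display)
    (T : measurableType d) (P : probability T R) (Z : I -> {RV P >-> R}) :
  measurable_fun setT
    (fun w => (fun i => Z i w) : g_sigma_algebraType (boxes R I)).
Proof.
apply: (@measurability _ _ T (g_sigma_algebraType (boxes R I)) setT
  (fun w i => Z i w) (boxes R I) erefl) => _ [_ [B mB ->] <-]; rewrite setTI.
rewrite [X in measurable X](_ : _ = \bigcap_(i in [set: I]) (Z i @^-1` B i)).
  by apply: fin_bigcap_measurable => // i _; exact: measurable_funPTI.
by apply/seteqP; split=> w /= h i; [move=> _|]; exact: h.
Qed.

(** On a box, independence turns the probability into a product of marginal
    probabilities, which a relabelling of the indices only permutes. *)
Lemma exchangeable (R : realType) (I : finType) (d : measure_display)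
    (T : measurableType d) (P : probability T R) (Z : I -> {RV P >-> R}) :
  mutually_independent Z ->
  (forall i j B, measurable B -> P (Z i @^-1` B) = P (Z j @^-1` B)) ->
  forall s : I -> I, injective s -> forall E : set (I -> R), (<<s boxes R I >>) E ->
  P [set w | E (fun i => Z i w)] = P [set w | E (fun i => Z (s i) w)].
Proof.
move=> indep idd s injs E mE.
pose f : {mfun T >-> g_sigma_algebraType (boxes R I)} :=
  mfun_Sub (mem_set (measurable_family Z)).
pose g : {mfun T >-> g_sigma_algebraType (boxes R I)} :=
  mfun_Sub (mem_set (measurable_family (Z \o s))).
have all_box (B : I -> set R) (Y : I -> {RV P >-> R}) :
    [set w | forall i, B i (Y i w)] =
    \bigcap_(i in [set` [set: I]%SET]) (Y i @^-1` B i).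
  by apply/seteqP; split=> w /= h i; [move=> _|]; apply: h => //=;
    rewrite finset.in_setT.
apply: (@measure_unique _ R (g_sigma_algebraType (boxes R I)) (boxes R I)
  (fun=> setT) _ _ _ _ (distribution P f) (distribution P g)) => //.
- move=> _ _ [A mA ->] [B mB ->]; exists (fun i => A i `&` B i).
    by move=> i; exact: measurableI.
  apply/seteqP; split=> z /=; first by move=> [hA hB] i; split.
  by move=> h; split=> i; have [] := h i.
- move=> _; exists (fun=> setT) => //; exact/seteqP.
- by rewrite bigcup_const.
- move=> _ [B mB ->]; rewrite /distribution /pushforward /=.
  rewrite [LHS](_ : _ = P [set w | forall i, B i (Z i w)]) //.
  rewrite [RHS](_ : _ = P [set w | forall i, B (invF injs i) (Z i w)]).
    rewrite (all_box B Z) (all_box (fun i => B (invF injs i)) Z) !indep //.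
    rewrite [RHS](reindex_inj injs) /=.
    apply: eq_big => i; rewrite ?inE // => _; rewrite invF_f; exact: idd.
  congr (P _); apply/seteqP; split=> w /= h i.
    by have := h (invF injs i); rewrite /= f_invF.
  by have := h (s i); rewrite invF_f.
- by move=> n; rewrite (le_lt_trans (probability_le1 _ _)) ?ltry.
Qed.

Lemma measurable_finite_preimage (S : finType) (d : measure_display)
    (T : measurableType d) (f : T -> S) :
  (forall b, measurable [set w | f w = b]) ->
  forall Q : S -> Prop, measurable [set w | Q (f w)].
Proof.
move=> mf Q.
rewrite (_ : [set w | _] = \bigcup_(b in [set b | Q b]) [set w | f w = b]).
  by apply: fin_bigcup_measurable.
by apply/seteqP; split=> w /=; [exists (f w)|case=> b /= ? ->].
Qed.

(** [lead] depends on the vector only through its finite matrix of comparisons,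
    whose fibres are finite intersections of comparison events. *)
Lemma lead_measurable (R : realType) (I : finType) (k : nat) (A : {set I}) :
  (<<s boxes R I >>) [set z | lead k A z].
Proof.
pose cmp (z : g_sigma_algebraType (boxes R I)) :=
  [ffun p : I * I => z p.1 <= z p.2].
pose Q (b : {ffun I * I -> bool}) := [exists j,
  (k + #|[pred i | (i \notin A) && b (i, j)]|
     <= #|[pred i in A | b (i, j)]|)%N].
have QE z : lead k A z = Q (cmp z).
  apply: eq_existsb => j; congr (_ + _ <= _)%N; apply: eq_card => i;
  by rewrite !inE ffunE.
under eq_set do rewrite QE.
apply: (@measurable_finite_preimage _ _ (g_sigma_algebraType (boxes R I)) cmp
  _ Q) => b.
rewrite (_ : [set w | _] =
  \bigcap_(p in [set: I * I]) [set z | (z p.1 <= z p.2) = b p]).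
  apply: fin_bigcap_measurable => // p _.
  have := measurable_fun_ler (@measurable_coord R I p.1) (measurable_coord p.2).
  by move=> /(_ measurableT [set b p]); rewrite setTI; apply.
apply/seteqP; split=> z /=; first by move=> <- p _; rewrite ffunE.
by move=> h; apply/ffunP => p; rewrite ffunE; exact: h.
Qed.

(** An atom at [x] would be a jump of the distribution function at [x]. *)
Lemma continuous_cdf_atom (R : realType) (d : measure_display)
    (T : measurableType d) (P : probability T R) (X : {RV P >-> R}) (F : R -> R) :
  continuous F -> (forall x, cdf X x = (F x)%:E) ->
  forall x, P (X @^-1` [set x]) = 0%E.
Proof.
move=> cF XF x; apply/eqP; rewrite eq_le measure_ge0 andbT leNgt.
have mX B : measurable B -> measurable (X @^-1` B) by exact: measurable_funPTI.
apply/negP => p0.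
have fp : P (X @^-1` [set x]) \is a fin_num by apply: fin_num_measure; exact: mX.
have {}p0 : 0 < fine (P (X @^-1` [set x])) by rewrite fine_gt0 // p0 ltey_eq fp.
near (at_left x) => y.
have yx : y < x by near: y; exact: nbhs_left_lt.
have : `|F x - F y| < fine (P (X @^-1` [set x])).
  near: y; have := cvg_at_left_filter (cF x).
  by move=> /cvgrPdist_lt /(_ _ p0).
rewrite ltNge => /negP; apply.
apply: le_trans (ler_norm _).
rewrite lerBrDl -lee_fin EFinD fineK // -!XF /cdf /distribution /pushforward.
rewrite -measureU; [|exact: mX|exact: mX|].
  apply: le_measure; rewrite ?inE; [apply: measurableU; exact: mX|exact: mX|].
  by move=> w /= [|->]; rewrite !in_itv //= => /le_trans; apply; exact: ltW.
rewrite -preimage_setI; apply/seteqP; split=> w //=; rewrite in_itv /= => -[+ e].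
by rewrite e leNgt yx.
Unshelve. all: by end_near. Qed.

(** The pair [(Z i, Z j)] has the product law, for which the diagonal is null
    because each of its sections is a single point, of mass zero. *)
Lemma no_ties (R : realType) (I : finType) (d : measure_display)
    (T : measurableType d) (P : probability T R) (Z : I -> {RV P >-> R})
    (F : R -> R) :
  mutually_independent Z -> continuous F ->
  (forall i x, cdf (Z i) x = (F x)%:E) ->
  forall i j, i != j -> P [set w | Z i w = Z j w] = 0%E.
Proof.
move=> indep cF ZF i j ij.
have mh : measurable_fun setT (fun w => (Z i w, Z j w)).
  by apply: measurable_fun_pair; exact: measurable_funPT.
pose h : {mfun T >-> (R * R)%type} := mfun_Sub (mem_set mh).
have mD : measurable [set p : R * R | p.1 = p.2].
  have := measurable_fun_eqr (@measurable_fst _ _ R R) measurable_snd.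
  move=> /(_ measurableT [set true] Logic.I) /=; rewrite setTI.
  by congr (measurable _); apply/seteqP; split=> p /= /eqP.
have <- : (distribution P (Z i) \x distribution P (Z j))%E
    [set p : R * R | p.1 = p.2] = P [set w | Z i w = Z j w].
  apply: (@product_measure_unique _ _ _ _ R (distribution P (Z i))
    (distribution P (Z j)) (distribution P h)) => //.
  move=> A B mA mB; rewrite /distribution /pushforward.
  pose C k := if k == i then A else B.
  have := indep [set i; j]%SET C _.
  rewrite finset.big_setU1 ?finset.inE //= finset.big_set1 /C eqxx eq_sym.
  rewrite (negbTE ij) => <-; last first.
    by move=> k _; case: ifP.
  congr (P _); apply/seteqP; split=> w /=.
    move=> [? ?] k /=; rewrite finset.inE => /orP[] /set1P ->;
    by rewrite ?eqxx 1?eq_sym ?(negbTE ij).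
  move=> hw; split.
    by have := hw i; rewrite /= eqxx; apply; rewrite finset.inE set11.
  by have := hw j; rewrite /= eq_sym (negbTE ij); apply; rewrite finset.inE set11 orbT.
rewrite /product_measure1 /=; apply: integral0_eq => x _ /=.
have -> : xsection [set p : R * R | p.1 = p.2] x = [set x].
  by apply/seteqP; split=> y /=; rewrite /xsection /= inE /= => ->.
exact: continuous_cdf_atom (ZF j) x.
Qed.

(** * The probability of a lead *)

Lemma lead_reindex (R : realType) (I : finType) (k : nat) (A : {set I})
    (z : I -> R) (s : I -> I) : injective s ->
  lead k A (z \o s) = lead k (s @: A) z.
Proof.
move=> injs.
have cards (Q : pred I) : #|[pred i | Q (s i)]| = #|Q|.
  by rewrite -!sum1_card [RHS](reindex_inj injs).
have inA j : #|[pred i in s @: A | z i <= z (s j)]| =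
    #|[pred i in A | (z \o s) i <= (z \o s) j]|.
  rewrite -cards; apply: eq_card => i.
  by rewrite !inE /= (finset.mem_imset _ _ injs).
have outA j : #|[pred i | (i \notin s @: A) && (z i <= z (s j))]| =
    #|[pred i | (i \notin A) && ((z \o s) i <= (z \o s) j)]|.
  rewrite -cards; apply: eq_card => i.
  by rewrite !inE /= (finset.mem_imset _ _ injs).
apply/existsP/existsP => -[j hj]; first by exists (s j); rewrite inA outA.
by exists (invF injs j); rewrite -inA -outA f_invF.
Qed.

(** Listing [A] and then its complement, and likewise for [B], and matching the
    two lists position by position. *)
Lemma equicard_imset (I : finType) (A B : {set I}) : #|A| = #|B| ->
  exists2 s : I -> I, injective s & s @: A = B.
Proof.
move=> AB.
pose l (D : {set I}) := enum D ++ enum (~: D).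
have ml D : l D =i I by move=> i; rewrite mem_cat !mem_enum !inE orbN.
have ul D : uniq (l D).
  rewrite cat_uniq !enum_uniq andbT; apply/hasPn => i.
  by rewrite !mem_enum finset.inE.
have sl D : size (l D) = #|I|.
  by rewrite -(card_uniqP (ul D)); apply: eq_card; exact: ml.
pose s i := nth i (l B) (index i (l A)).
have lt_index i : (index i (l A) < size (l B))%N.
  by rewrite sl -(sl A) index_mem ml.
have injs : injective s.
  move=> i j; rewrite /s (set_nth_default j) // => /eqP.
  rewrite nth_uniq // => /eqP ij.
  by rewrite -(nth_index i (_ : i \in l A)) ?ml // ij nth_index ?ml.
exists s => //; apply/eqP.
rewrite eqEcard (card_imset _ injs) AB leqnn andbT.
apply/fintype.subsetP => _ /imsetP[i iA ->].
rewrite /s nth_cat -cardE -AB cardE.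
have iA' : i \in enum A by rewrite mem_enum.
rewrite index_cat iA' index_mem iA' -mem_enum mem_nth //.
by rewrite -cardE -AB cardE index_mem.
Qed.

Section Law.
Context (R : realType) (I : finType) (d : measure_display)
  (T : measurableType d) (P : probability T R) (Z : I -> {RV P >-> R})
  (F : R -> R).
Context (indep : mutually_independent Z) (contF : continuous F)
  (cdfZ : forall i x, cdf (Z i) x = (F x)%:E).

Let leading k A := [set w | lead k A (fun i => Z i w)].

Let measurable_leading k A : measurable (leading k A).
Proof.
have := measurable_family Z measurableT (lead_measurable k A).
by rewrite setTI.
Qed.

Let leading_equicard k (A B : {set I}) : #|A| = #|B| ->
  P (leading k A) = P (leading k B).
Proof.
move=> /equicard_imset[s injs <-].
have idd i j B' : measurable B' -> P (Z i @^-1` B') = P (Z j @^-1` B').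
  by apply: eq_cdf_law => x; rewrite !cdfZ.
rewrite (exchangeable indep idd injs (lead_measurable k A)).
by congr (P _); apply/seteqP; split=> w /=; rewrite (lead_reindex _ _ (fun i => Z i w)).
Qed.

Let ae_injective : {ae P, forall w, injective (fun i => Z i w)}.
Proof.
have ae_ne (p : I * I) : {ae P, forall w, Z p.1 w = Z p.2 w -> p.1 = p.2}.
  have [e|ne] := eqVneq p.1 p.2; first exact: aeW.
  have mE : measurable [set w | Z p.1 w = Z p.2 w].
    have := measurable_fun_eqr (@measurable_funPT _ _ _ _ (Z p.1))
      (@measurable_funPT _ _ _ _ (Z p.2)).
    move=> /(_ measurableT [set true] Logic.I) /=; rewrite setTI.
    by congr (measurable _); apply/seteqP; split=> w /= /eqP.
  exists [set w | Z p.1 w = Z p.2 w]; split => //.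
    exact: (no_ties indep contF cdfZ).
  by move=> w /= /not_implyP[].
have : {ae P, forall w (p : I * I), Z p.1 w = Z p.2 w -> p.1 = p.2}.
  exact: filter_forall.
by apply: filterS => w h i j /(h (i, j)).
Qed.

(** The sum of the probabilities is the expected number of leading sets, and that
    number is almost surely constant, by [card_lead]. *)
Let sum_leading k a : (0 < k)%N -> (2 * a <= #|I| + k)%N ->
  (\sum_(B : {set I} | #|B| == a) P (leading k B) =
    'C(#|I|, #|I| + k - a)%:R%:E)%E.
Proof.
move=> k0 ha.
transitivity (\int[P]_w \sum_(B <- enum [pred B : {set I} | #|B| == a])
    (\1_(leading k B) w)%:E)%E.
  rewrite ge0_integral_sum //; last first.
    by move=> B; apply/measurable_EFinP; exact: measurable_indic.
  rewrite big_enum /=; apply: eq_bigr => B _.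
  by rewrite integral_indic // setIT.
rewrite (ge0_ae_eq_integral (g := cst ('C(#|I|, #|I| + k - a)%:R%:E))) //=.
- rewrite integral_cst //; transitivity ('C(#|I|, #|I| + k - a)%:R%:E * 1 : \bar R)%E.
    by congr (_ * _)%E; exact: probability_setT.
  exact: mule1.
- by apply: emeasurable_sum => B; apply/measurable_EFinP; exact: measurable_indic.
- by move=> w _; apply: sume_ge0.
- apply: filterS ae_injective => w injw _.
  rewrite big_enum /= sumEFin -(card_lead injw k0 ha) -sum1_card natr_sum.
  congr (_%:E).
  rewrite [RHS](eq_bigl (fun B : {set I} =>
    (#|B| == a) && lead k B (fun i => Z i w))) //.
  rewrite [RHS]big_mkcondr; apply: eq_bigr => B _ /=.
  rewrite indicE; case: (boolP (lead _ _ _)) => h; first by rewrite mem_set.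
  by rewrite memNset //; exact/negP.
Qed.

(** All sets of the same size have the same probability of leading, so each of
    them carries an equal share of [sum_leading]. *)
Lemma prob_lead (k : nat) (A : {set I}) : (0 < k)%N -> (2 * #|A| <= #|I| + k)%N ->
  P (leading k A) =
    ('C(#|I|, #|I| + k - #|A|)%:R / 'C(#|I|, #|A|)%:R)%:E.
Proof.
move=> k0 hA.
have := sum_leading k0 hA.
rewrite (eq_bigr (fun=> P (leading k A))); last first.
  by move=> B /eqP; exact: leading_equicard.
rewrite big_const.
have /fineK <- : P (leading k A) \is a fin_num by exact: fin_num_measure.
set p := fine _; set c := #|_| => e.
have -> : 'C(#|I|, #|A|) = c by rewrite -card_draws cardsE.
have c0 : (0 < c)%N by apply/card_gt0P; exists A; exact: (eqxx #|A|).
have iterD : iter c (fun x => (p%:E + x)%E) 0%E = (p *+ c)%:E.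
  by elim: (c) => //= m ->; rewrite mulrS EFinD.
move: e; rewrite iterD => -[<-].
by rewrite -[p *+ c]mulr_natr mulfK // pnatr_eq0 -lt0n.
Qed.

End Law.

(** * The exact tail of the one-sided statistic *)

(** Reduces the supremum over all reals to the data points: a difference of two
    empirical distribution functions vanishes to the left of all the data and
    elsewhere takes its value at a data point.  The value 0 is discarded by
    [0 < c]. *)
Lemma sup_step (R : realType) (I : finType) (f : R -> R) (z : I -> R) (c : R) :
  (forall u, f u = 0 \/ exists j, f u = f (z j)) -> 0 < c ->
  (c <= sup (range f)) = [exists j, c <= f (z j)].
Proof.
move=> fz c0.
pose m := \big[Num.max/0]_j f (z j).
have ubm : ubound (range f) m.
  move=> _ [u _ <-]; have [->|[j ->]] := fz u; first exact: bigmax_ge_id.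
  exact: le_bigmax.
apply/idP/existsP => [csup|[j cj]].
  apply/existsP; rewrite -[X in is_true X]negbK negb_exists; apply/negP => /forallP lt_c.
  move: csup; apply/negP; rewrite -ltNge; apply: (@le_lt_trans _ _ m).
    by apply: ge_sup => //; exists (f 0); exists 0.
  by apply: bigmax_lt => // j _; rewrite ltNge.
apply: le_trans cj _; apply: ub_le_sup; first by exists m.
by exists (z j).
Qed.

Definition pooled (R : realType) (n : nat) (x y : 'I_n -> R) (i : 'I_n + 'I_n)
    : R :=
  match i with inl i => x i | inr i => y i end.

Definition first_sample (n : nat) : {set 'I_n + 'I_n} :=
  [set i | if i is inl _ then true else false]%SET.

Lemma card_first_sample n : #|first_sample n| = n.
Proof.
rewrite -sum1_card big_sumType /= [X in (_ + X)%N]big_pred0 ?addn0.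
  rewrite (eq_bigl xpredT) => [|i]; last by rewrite !inE.
  by rewrite sum1_card card_ord.
by move=> i; rewrite !inE.
Qed.

Lemma ecdfB (R : realType) (n : nat) (x y : 'I_n -> R) (u : R) :
  ecdf x u - ecdf y u = n%:R^-1 *
    (#|[pred i in first_sample n | pooled x y i <= u]|%:R -
     #|[pred i | (i \notin first_sample n) && (pooled x y i <= u)]|%:R).
Proof.
rewrite /ecdf -mulrBr; congr (_ * (_ - _)).
  rewrite -sum1_card natr_sum big_sumType /= [X in _ + X]big_pred0 ?addr0.
    by rewrite [RHS]big_mkcond; apply: eq_bigr => i _; rewrite !inE; case: (_ <= _).
  by move=> i; rewrite !inE.
rewrite -sum1_card natr_sum big_sumType /= [X in X + _]big_pred0 ?add0r.
  by rewrite [RHS]big_mkcond; apply: eq_bigr => i _; rewrite !inE; case: (_ <= _).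
by move=> i; rewrite !inE.
Qed.

(** The least lead that makes the statistic at least [t]: a lead of [m] gives
    [sqrt (n / 2) * (m / n) = m / sqrt (2n)]. *)
Definition level (R : realType) (n : nat) (t : R) : nat :=
  `|Num.ceil (t * Num.sqrt (2 * n)%:R)|%N.

Lemma level_gt0 (R : realType) (n : nat) (t : R) : (0 < n)%N -> 0 < t ->
  (0 < level n t)%N.
Proof.
move=> n0 t0; rewrite lt0n absz_eq0 gt_eqF // ceil_gt0.
by rewrite mulr_gt0 // sqrtr_gt0 ltr0n; lia.
Qed.

(** The tail is constant between two consecutive levels whereas the Gaussian
    decreases in [t], so it is enough to compare them at the levels. *)
Lemma level_ge (R : realType) (n : nat) (t : R) : (0 < n)%N -> 0 < t ->
  2 * t ^+ 2 <= (level n t)%:R ^+ 2 / n%:R.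
Proof.
move=> n0 t0; rewrite ler_pdivlMr ?ltr0n //.
have s0 : 0 <= t * Num.sqrt (2 * n)%:R :> R by rewrite mulr_ge0 ?sqrtr_ge0 // ltW.
have -> : 2 * t ^+ 2 * n%:R = (t * Num.sqrt (2 * n)%:R) ^+ 2.
  by rewrite exprMn sqr_sqrtr ?ler0n // natrM; ring.
rewrite lerXn2r ?nnegrE //.
rewrite /level natr_absz ger0_norm; first by rewrite -ceil_le_int.
by rewrite ceil_ge0 (lt_le_trans (ltrN10 _)).
Qed.

Lemma level_isqrt (R : realType) (n : nat) : (0 < n)%N ->
  level n ((Num.sqrt (2 * n)%:R)^-1 : R) = 1%N.
Proof.
move=> n0; rewrite /level mulVf ?ceil1 //.
by rewrite gt_eqF // sqrtr_gt0 ltr0n; lia.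
Qed.

Lemma levelP (R : realType) (n : nat) (t : R) (a b : nat) : (0 < n)%N -> 0 < t ->
  (t / Num.sqrt (n%:R / 2) <= n%:R^-1 * (a%:R - b%:R)) = (level n t + b <= a)%N.
Proof.
move=> n0 t0.
have n0R : (0 : R) < n%:R by rewrite ltr0n.
have s0 : 0 < Num.sqrt (n%:R / 2 : R) by rewrite sqrtr_gt0 divr_gt0.
have s20 : 0 < Num.sqrt ((2 * n)%:R : R) by rewrite sqrtr_gt0 ltr0n; lia.
have ss : Num.sqrt (n%:R / 2) * Num.sqrt ((2 * n)%:R) = n%:R :> R.
  rewrite -sqrtrM ?divr_ge0 ?ler0n // natrM mulrA divfK // -expr2 sqrtr_sqr.
  by rewrite ger0_norm ?ler0n.
rewrite mulrC ler_pdivrMl // mulrCA.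
have -> : n%:R^-1 * (Num.sqrt (n%:R / 2) * (a%:R - b%:R)) =
  (Num.sqrt (2 * n)%:R)^-1 * (a%:R - b%:R) :> R.
  rewrite mulrA; congr (_ * _); apply: (mulfI (lt0r_neq0 n0R)).
  rewrite mulrA divff ?mul1r ?lt0r_neq0 // -[in RHS]ss mulfK // lt0r_neq0 //.
rewrite ler_pdivlMl // mulrC.
have -> : a%:R - b%:R = (a%:Z - b%:Z)%:~R :> R by rewrite intrB.
rewrite -ceil_le_int /level.
have : 0 <= Num.ceil (t * Num.sqrt (2 * n)%:R).
  by rewrite ceil_ge0 (lt_trans (ltrN10 _)) // mulr_gt0.
by move: (Num.ceil _) => c; lia.
Qed.

Lemma ks_plus_ge (R : realType) (n : nat) (x y : 'I_n -> R) (t : R) :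
  (0 < n)%N -> 0 < t ->
  (t <= ks_plus x y) = lead (level n t) (first_sample n) (pooled x y).
Proof.
move=> n0 t0.
have s0 : 0 < Num.sqrt (n%:R / 2 : R) by rewrite sqrtr_gt0 divr_gt0 // ltr0n.
rewrite /ks_plus mulrC -ler_pdivrMr // (@sup_step _ _ _ (pooled x y)) ?divr_gt0 //.
  by apply: eq_existsb => j; rewrite ecdfB levelP.
move=> u; case: (pickP (fun i => pooled x y i <= u)) => [i0 i0u|none]; last first.
  left; rewrite ecdfB !eq_card0 ?subrr ?mulr0 // => i; rewrite !inE none andbF //.
right; have [//|] := @arg_maxP _ _ _ i0 (fun i => pooled x y i <= u) (pooled x y) _.
move=> j ju jmax; exists j.
have same i : (pooled x y i <= u) = (pooled x y i <= pooled x y j).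
  by apply/idP/idP => [/jmax //|/le_trans]; apply.
rewrite !ecdfB; congr (_ * (_%:R - _%:R)); apply: eq_card => i;
by rewrite !inE same.
Qed.

(** Gnedenko-Korolyuk formula: [prob_lead] for the pooled sample, with the
    first-sample indices as the leading set. *)
Lemma ks_plus_tailE (R : realType) (d : measure_display)
    (T : measurableType d) (P : probability T R) (n : nat)
    (X Y : 'I_n -> {RV P >-> R}) (F : R -> R) (t : R) :
  (0 < n)%N -> mutually_independent (joint_sample X Y) -> continuous F ->
  (forall i x, cdf (X i) x = (F x)%:E) ->
  (forall i x, cdf (Y i) x = (F x)%:E) -> 0 < t ->
  ks_plus_tail X Y t =
    ('C(2 * n, n + level n t)%:R / 'C(2 * n, n)%:R)%:E.
Proof.
move=> n0 indep cF XF YF t0.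
have cdfZ i x : cdf (joint_sample X Y i) x = (F x)%:E
  by case: i => i; [exact: XF|exact: YF].
have cardI : #|{: 'I_n + 'I_n}| = (2 * n)%N by rewrite card_sum !card_ord addnn mul2n.
have k0 := level_gt0 n0 t0.
have := prob_lead indep cF cdfZ (A := first_sample n) k0.
rewrite cardI card_first_sample (_ : 2 * n + level n t - n = n + level n t)%N; last by lia.
move=> <-; last by lia.
rewrite /ks_plus_tail; congr (P _); apply/seteqP; split=> w /=;
rewrite ks_plus_ge //; congr (is_true (lead _ _ _)); apply/funext => -[] //.
Qed.

(** * Estimates for the ratio of binomial coefficients *)

Definition log1p_poly (R : realType) (u : R) : R :=
  u - u ^+ 2 / 2 + u ^+ 3 / 3 - u ^+ 4 / 4.

(** The derivative is [u ^+ 4 * expR (- log1p_poly u)]: as a truncated geometric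
    series, the derivative of [log1p_poly] is [(1 - u ^+ 4) / (1 + u)].  Having
    monotonicity on the whole line allows a comparison of [- x] with [x]. *)
Lemma log1p_poly_homo (R : realType) :
  {homo (fun u : R => (1 + u) * expR (- log1p_poly u)) : u v / u <= v}.
Proof.
move=> u v uv.
have dG (x : R) : is_derive x (1 : R) (fun u : R => (1 + u) * expR (- log1p_poly u))
    (x ^+ 4 * expR (- log1p_poly x)).
  rewrite /log1p_poly; apply: is_derive_eq.
  by rewrite /GRing.scale /=; field.
have dG' x : derivable (fun u : R => (1 + u) * expR (- log1p_poly u)) x (1 : R).
  exact: ex_derive.
have h := @ger0_derive1_ndecr R _ u v (fun x _ => dG' x) _ _ u v
  (lexx u) uv (lexx v).
apply: h => [x _|].
  by rewrite derive1E derive_val mulr_ge0 ?expR_ge0 // exprn_even_ge0.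
by apply: derivable_within_continuous => x _; exact: dG'.
Qed.

Lemma expR_log1p_poly (R : realType) (u : R) : 0 <= u ->
  expR (log1p_poly u) <= 1 + u.
Proof.
move=> u0; have := log1p_poly_homo u0.
rewrite (_ : log1p_poly 0 = 0); last by rewrite /log1p_poly; field.
by rewrite oppr0 expR0 mulr1 addr0 expRN ler_pdivlMr ?expR_gt0 // mul1r.
Qed.

(** Comparing [log1p_poly_homo] at [- x] and at [x], the even-degree terms of
    [log1p_poly] cancel. *)
Lemma sub1_le_expR (R : realType) (x : R) : 0 <= x ->
  1 - x <= (1 + x) * expR (- (2 * x) - 2 / 3 * x ^+ 3).
Proof.
move=> x0; have xx : - x <= x by lra.
have := log1p_poly_homo xx; rewrite -[leLHS]/((1 - x) * _) => h.
rewrite -(ler_pM2r (expR_gt0 (- log1p_poly (- x)))) (le_trans h) //.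
rewrite -[leRHS]mulrA -expRD le_eqVlt; apply/orP; left; apply/eqP.
by congr (_ * expR _); rewrite /log1p_poly; field.
Qed.

Definition central_ratio (R : realType) (n k : nat) : R :=
  'C(2 * n, n + k)%:R / 'C(2 * n, n)%:R.
Arguments central_ratio R n k : clear implicits.

Lemma central_ratio_ge0 (R : realType) n k : 0 <= central_ratio R n k.
Proof. by rewrite divr_ge0. Qed.

Lemma central_ratioS (R : realType) (n k : nat) : (0 < n)%N ->
  (1 + k.+1%:R / n%:R) * central_ratio R n k.+1 =
  (1 - k%:R / n%:R) * central_ratio R n k.
Proof.
move=> n0; rewrite /central_ratio !mulrA; congr (_ / _).
have n0R : n%:R != 0 :> R by rewrite pnatr_eq0 -lt0n.
apply: (mulfI n0R); rewrite !mulrA !mulrDr mulr1 !mulrN ![n%:R * (_ / _)]mulrC !divfK //.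
have := mul_bin_left (2 * n) (n + k).
have [kn e|nk _] := leqP k n.
  rewrite -natrD -natrM -addnS in e * => //; rewrite -natrB // -natrM e.
  by congr (_ * _)%:R; lia.
by rewrite !bin_small ?mulr0 //; lia.
Qed.

(** Induction on [k], using [sub1_le_expR] at [x = i / n] for each factor of the
    product.  The exponents add up through [2 * sum_(i < k) i = k (k - 1)] and
    [4 * sum_(i < k) i^3 = k^2 (k - 1)^2], and are then rewritten in terms of
    [u]: the first sum gives [- k^2 / n + u], the second one the quartic term. *)
Lemma central_ratio_bound (R : realType) (n k : nat) : (0 < n)%N -> (0 < k)%N ->
  let u : R := k%:R / n%:R in
  (1 + u) * central_ratio R n k <=
  expR (u - n%:R / 6 * u ^+ 2 * (u - n%:R^-1) ^+ 2) * expR (- (k%:R ^+ 2 / n%:R)).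
Proof.
move=> n0; have n0R : (0 : R) < n%:R by rewrite ltr0n.
have n0R' := lt0r_neq0 n0R.
have r0 : central_ratio R n 0 = 1.
  by rewrite /central_ratio addn0 divff // pnatr_eq0 -lt0n bin_gt0; lia.
case: k => // k _; cbv zeta; rewrite -expRD.
elim: k => [|k IH].
  rewrite central_ratioS // r0 mul0r subr0 mulr1 -[leLHS]expR0 ler_expR.
  by rewrite le_eqVlt; apply/orP; left; apply/eqP; field.
rewrite central_ratioS //.
set x : R := k.+1%:R / n%:R.
have x0 : 0 <= x by rewrite divr_ge0.
apply: (@le_trans _ _ ((1 + x) * expR (- (2 * x) - 2 / 3 * x ^+ 3) * central_ratio R n k.+1)).
  by rewrite ler_wpM2r ?central_ratio_ge0 // sub1_le_expR.
rewrite mulrAC; apply: le_trans (ler_wpM2r (expR_ge0 _) IH) _.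
rewrite -expRD ler_expR le_eqVlt; apply/orP; left; apply/eqP; rewrite -/x.
by rewrite -[k.+2]addn1 natrD /x; field.
Qed.

(** Reduces a Gaussian bound to an inequality in [u = k / n] alone.  Only
    [1 <= k <= n] matters, because the ratio vanishes beyond [n]. *)
Lemma central_ratio_le_of (R : realType) (n k : nat) (C : R) : (0 < n)%N ->
  (0 < k)%N -> 0 <= C ->
  (let u : R := k%:R / n%:R in u <= 1 -> n%:R^-1 <= u ->
   expR (u - n%:R / 6 * u ^+ 2 * (u - n%:R^-1) ^+ 2) <= C * (1 + u)) ->
  central_ratio R n k <= C * expR (- (k%:R ^+ 2 / n%:R)).
Proof.
move=> n0 k0 C0 hC; have n0R : (0 : R) < n%:R by rewrite ltr0n.
have [kn|nk] := leqP k n; last first.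
  by rewrite /central_ratio bin_small ?mul0r ?mulr_ge0 ?expR_ge0 //; lia.
set u : R := k%:R / n%:R.
have u1 : u <= 1 by rewrite ler_pdivrMr // mul1r ler_nat.
have u0 : n%:R^-1 <= u by rewrite ler_pdivlMr // mulVf ?lt0r_neq0 // ler1n.
have pu : 0 < 1 + u by rewrite ltr_wpDr // divr_ge0.
have := central_ratio_bound R n0 k0; cbv zeta; rewrite -/u => h.
rewrite -(ler_pM2l pu) (le_trans h) // [leRHS]mulrCA [leRHS]mulrA.
by rewrite ler_wpM2r ?expR_ge0 // hC.
Qed.

Lemma central_ratio_le_half_e (R : realType) (n k : nat) : (0 < n)%N -> (0 < k)%N ->
  central_ratio R n k <= expR 1 / 2 * expR (- (k%:R ^+ 2 / n%:R)).
Proof.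
move=> n0 k0; apply: central_ratio_le_of => // u u1 u0.
have un : 0 <= u by rewrite (le_trans _ u0) // invr_ge0.
apply: (@le_trans _ _ (expR u)).
  by rewrite ler_expR gerBl mulr_ge0 ?sqr_ge0 // mulr_ge0 ?sqr_ge0 ?divr_ge0.
(* Here [2 * expR (u - 1) <= 2 / (2 - u) <= 1 + u], the last step because
   [(1 + u) * (2 - u) = 2 + u * (1 - u)]. *)
have h : 2 - u <= expR (1 - u) by have := expR_ge1Dx (1 - u); lra.
have e1 : expR 1 = expR u * expR (1 - u) by rewrite -expRD; congr expR; ring.
rewrite e1 -mulrA -mulrA ler_peMr ?expR_ge0 //.
by nra.
Qed.

Lemma central_ratio_le_gaussian (R : realType) (n k : nat) : (0 < n)%N -> (0 < k)%N ->
  central_ratio R n k <=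
    expR (- ((1 - (2 * n%:R)^-1) * (k%:R ^+ 2 / n%:R))).
Proof.
move=> n0 k0.
have n0R : (0 : R) < n%:R by rewrite ltr0n.
have n0R' := lt0r_neq0 n0R.
rewrite [X in expR X](_ : _ = (k%:R / n%:R) ^+ 2 / 2 - k%:R ^+ 2 / n%:R); last by field.
rewrite expRD.
apply: central_ratio_le_of => // u u1 u0.
rewrite -/u.
have un : 0 <= u by rewrite (le_trans _ u0) // invr_ge0.
apply: (@le_trans _ _ (expR (u ^+ 2 / 2) * expR (log1p_poly u))); last first.
  by rewrite ler_wpM2l ?expR_ge0 // expR_log1p_poly.
rewrite -expRD ler_expR /log1p_poly.
have : 0 <= n%:R / 6 * u ^+ 2 * (u - n%:R^-1) ^+ 2.
  by rewrite mulr_ge0 ?sqr_ge0 // mulr_ge0 ?sqr_ge0 ?divr_ge0.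
have : u ^+ 4 / 4 <= u ^+ 3 / 3.
  have -> : u ^+ 4 = u ^+ 3 * u by ring.
  have := exprn_ge0 3 un; nra.
lra.
Qed.

Definition gaussian_const5 (R : realType) : R := (2 + 168 / 10 ^+ 3 + 63 / 10 ^+ 5) / 2.
Arguments gaussian_const5 R : clear implicits.

(** [3/40] is a convenient upper bound for the excess exponent in
    [central_ratio_le_const5]. *)
Lemma expR_excess_le (R : realType) : expR (3 / 40) <= gaussian_const5 R.
Proof.
have h : 1 - 3 / 40 <= expR (- (3 / 40)) :> R by have := expR_ge1Dx (- (3 / 40) : R); lra.
have := expRxMexpNx_1 (3 / 40 : R); have := expR_gt0 (3 / 40 : R).
rewrite /gaussian_const5 => p0 e.
nra.
Qed.

(** Needed for [n = 5, k = 3], where the ratio is [45 / 252 = 5 / 28] and the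
    exponent is [- 9 / 5]. *)
Lemma expR_9_5 (R : realType) : expR (9 / 5) <= 6 + 7 / 100 :> R.
Proof.
(* A rational just above [exp (1/5) - 1], rounded so that [log1p_poly u] is still
   at least [1/5]; it is kept abstract so that it is not computed with. *)
have [u ue] : exists u : R, u = 277 / 1250 by exists (277 / 1250).
have u0 : 0 <= u by lra.
have h : expR (9 / 5) <= (1 + u) ^+ 9.
  apply: (@le_trans _ _ (expR (log1p_poly u) ^+ 9)).
    by rewrite -expRM_natl ler_expR /log1p_poly ue; lra.
  rewrite lerXn2r ?nnegrE ?expR_ge0 ?expR_log1p_poly //.
  by rewrite addr_ge0.
(* A short upper bound of the cube, with [b ^+ 3 <= 6.07]. *)
have [b be] : exists b : R, b = 228 / 125 by exists (228 / 125).
have cube : (1 + u) ^+ 3 <= b by rewrite ue be; lra.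
have cube0 : 0 <= (1 + u) ^+ 3 by rewrite exprn_ge0 // addr_ge0.
apply: (le_trans h); rewrite (exprM _ 3 3).
apply: (@le_trans _ _ (b ^+ 3)); last by rewrite be; lra.
by rewrite lerXn2r ?nnegrE // (le_trans cube0 cube).
Qed.

(** After [1 + u] is bounded below by [expR_log1p_poly], the cubic terms cancel
    and the excess exponent is at most a quadratic in [s = u ^+ 2].  Its
    maximum over [s] is below [3/40] for [n >= 6].  For [n = 5] the maximum is
    too large, but among the values [u = k / 5] only [k = 3] comes near it. *)
Lemma central_ratio_le_const5 (R : realType) (n k : nat) : (5 <= n)%N -> (0 < k)%N ->
  central_ratio R n k <= gaussian_const5 R * expR (- (k%:R ^+ 2 / n%:R)).
Proof.
move=> n5 k0.
have n0 : (0 < n)%N by lia.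
have C0 : 0 <= gaussian_const5 R by rewrite /gaussian_const5; lra.
have [/andP[/eqP -> /eqP ->]|nk] := boolP ((n == 5) && (k == 3))%N.
  rewrite /central_ratio /= (_ : 'C(2 * 5, 5 + 3) = 45)%N // (_ : 'C(2 * 5, 5) = 252)%N //.
  rewrite expRN -ler_pdivrMr ?invr_gt0 ?expR_gt0 // invrK.
  rewrite (_ : 3 ^+ 2 / 5 = 9 / 5 :> R); last by lra.
  by have := expR_9_5 R; rewrite /gaussian_const5; lra.
apply: central_ratio_le_of => // u u1 u0.
have n0R : (0 : R) < n%:R by rewrite ltr0n.
have n0R' := lt0r_neq0 n0R.
have un : 0 <= u by rewrite (le_trans _ u0) // invr_ge0.
apply: (@le_trans _ _ (expR (3 / 40) * expR (log1p_poly u))); last first.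
  exact: ler_pM (expR_ge0 _) (expR_ge0 _) (expR_excess_le R) (expR_log1p_poly un).
rewrite -expRD ler_expR /log1p_poly.
have -> : n%:R / 6 * u ^+ 2 * (u - n%:R^-1) ^+ 2 =
   n%:R / 6 * u ^+ 4 - u ^+ 3 / 3 + n%:R^-1 / 6 * u ^+ 2 by field.
suff : (1 / 2 - n%:R^-1 / 6) * u ^+ 2 - (n%:R / 6 - 1 / 4) * (u ^+ 2) ^+ 2 <= 3 / 40.
  by rewrite -exprM; lra.
have [n7|n7] := leqP 7 n.
  have : (7 : R) <= n%:R by rewrite ler_nat.
  have : 0 <= n%:R^-1 :> R by rewrite invr_ge0.
  (* For [n = 7] and [1/n] dropped, the quadratic peaks at [s = 3/11]. *)
  have := sqr_ge0 u; have := sqr_ge0 (u ^+ 2 - 3 / 11).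
  move: (u ^+ 2) => s; move: (n%:R : R) (n%:R^-1 : R) => m v sq s0 v0 m7.
  have m7' : 0 <= m - 7 by lra.
  have := mulr_ge0 v0 s0; have := mulr_ge0 m7' (sqr_ge0 s); nra.
have [n6|n6] := eqVneq n 6%N.
  (* The quadratic [17/36 * s - 3/4 * s ^+ 2] peaks at [s = 17/54]. *)
  rewrite n6; have := sqr_ge0 (u ^+ 2 - 17 / 54); nra.
have n5' : n = 5 by lia.
rewrite /u n5' in u1 nk *.
have k5 : (k <= 5)%N by rewrite ler_pdivrMr // mul1r ler_nat in u1.
by case: k k0 k5 nk {u u1 u0 un} => [|[|[|[|[|[|]]]]]] // _ _ _; lra.
Qed.

(** Equivalent to [1 + 1 / n < exp (1 / n)]. *)
Lemma gaussian_lt_central_ratio (R : realType) (n : nat) : (0 < n)%N ->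
  expR (- (n%:R)^-1) < central_ratio R n 1.
Proof.
move=> n0; have n0R : (0 : R) < n%:R by rewrite ltr0n.
have n0R' := lt0r_neq0 n0R.
have := central_ratioS R 0 n0; rewrite mul0r subr0 mul1r.
rewrite [X in _ = X]/central_ratio addn0 divff ?pnatr_eq0 -?lt0n ?bin_gt0; last by lia.
rewrite ?mulr1 ?div1r => e.
have p0 : 0 < 1 + n%:R^-1 :> R by rewrite addr_gt0 ?invr_gt0.
rewrite -(ltr_pM2l p0) e expRN ltr_pdivrMr ?expR_gt0 // mul1r.
by rewrite expR_gt1Dx // invr_neq0.
Qed.

(** * The four inequalities *)

(* MathComp-Analysis. *)
Theorem theorem6 (R : realType) (d : measure_display) (T : measurableType d)
    (P : probability T R) (n : nat) (hn : (1 <= n)%N)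
    (X Y : 'I_n -> {RV P >-> R}) (F : R -> R)
    (indep : mutually_independent (joint_sample X Y))
    (contF : continuous F)
    (cdfX : forall i x, cdf (X i) x = (F x)%:E)
    (cdfY : forall i x, cdf (Y i) x = (F x)%:E) :
  [/\ (* (a) *)
      (forall t : R, 0 < t ->
        (ks_plus_tail X Y t <= (expR 1 / 2 * expR (- 2 * t ^+ 2))%:E)%E)
      /\
      (n = 1%N ->
        ks_plus_tail X Y (1 / Num.sqrt 2) =
          (expR 1 / 2 * expR (- 2 * (1 / Num.sqrt 2) ^+ 2))%:E
        /\ (forall C : R,
             (forall t : R, 0 < t ->
               (ks_plus_tail X Y t <= (C * expR (- 2 * t ^+ 2))%:E)%E) ->
             expR 1 / 2 <= C)),
      (* (b), with the decimal 2.16863 = 2 + 168/10^3 + 63/10^5 *)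
      ((5 <= n)%N -> forall t : R, 0 < t ->
        (ks_plus_tail X Y t <=
          ((2 + 168 / 10 ^+ 3 + 63 / 10 ^+ 5) / 2 * expR (- 2 * t ^+ 2))%:E)%E),
      (* (c) *)
      (exists t : R,
        0 < t /\ ((expR (- 2 * t ^+ 2))%:E < ks_plus_tail X Y t)%E)
    & (* (d) *)
      (let N : R := (2 * n)%:R in
       forall t : R, 0 < t ->
        (ks_plus_tail X Y t <= (expR (- 2 * ((N - 1) / N) * t ^+ 2))%:E)%E)].
Proof.
have n0 : (0 < n)%N := hn.
have n0R : (0 : R) < n%:R by rewrite ltr0n.
have tail t : 0 < t -> ks_plus_tail X Y t = (central_ratio R n (level n t))%:E.
  exact: ks_plus_tailE.
have sq2n : 0 < (Num.sqrt (2 * n)%:R)^-1 :> R.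
  by rewrite invr_gt0 sqrtr_gt0 ltr0n; lia.
have sq2nE : - 2 * (Num.sqrt (2 * n)%:R)^-1 ^+ 2 = - n%:R^-1 :> R.
  rewrite exprVn sqr_sqrtr ?ler0n // natrM; field; exact: lt0r_neq0.
(* Any bound at the levels [k] extends to every [t]. *)
have upper (C t : R) : 0 <= C -> 0 < t ->
    central_ratio R n (level n t) <=
      C * expR (- ((level n t)%:R ^+ 2 / n%:R)) ->
    (ks_plus_tail X Y t <= (C * expR (- 2 * t ^+ 2))%:E)%E.
  move=> C0 t0 hC; rewrite tail // lee_fin (le_trans hC) // ler_wpM2l //.
  by rewrite ler_expR mulNr lerN2 level_ge.
split.
- split=> [t t0|n1].
    apply: upper => //.
    exact: central_ratio_le_half_e (level_gt0 n0 t0).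
  have eq1 : ks_plus_tail X Y (1 / Num.sqrt 2) =
      (expR 1 / 2 * expR (- 2 * (1 / Num.sqrt 2) ^+ 2))%:E.
    have -> : 1 / Num.sqrt 2 = (Num.sqrt (2 * n)%:R)^-1 :> R by rewrite n1 muln1 div1r.
    rewrite tail // level_isqrt // sq2nE n1 invr1 mulrAC -expRD subrr expR0.
    by rewrite /central_ratio.
  split=> // C hC.
  have := hC (1 / Num.sqrt 2); rewrite eq1 lee_fin ler_pM2r ?expR_gt0 //.
  by apply; rewrite divr_gt0 // sqrtr_gt0.
- move=> n5 t t0; apply: (upper _ _ _ t0); first by lra.
  exact: central_ratio_le_const5 n5 (level_gt0 n0 t0).
- exists (Num.sqrt (2 * n)%:R)^-1; split => //.
  by rewrite tail // level_isqrt // sq2nE lte_fin gaussian_lt_central_ratio.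
- move=> N t t0; rewrite tail // lee_fin.
  apply: le_trans (central_ratio_le_gaussian R n0 (level_gt0 n0 t0)) _.
  rewrite ler_expR -mulNr.
  have -> : - 2 * ((N - 1) / N) * t ^+ 2 = - (1 - (2 * n%:R)^-1) * (2 * t ^+ 2).
    by rewrite /N natrM; field; exact: lt0r_neq0.
  rewrite !mulNr lerN2 ler_wpM2l ?level_ge // subr_ge0 invf_le1 ?mulr_gt0 //.
  have : (1 : R) <= n%:R by rewrite ler1n.
  lra.
Qed.
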